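(* The characteristic word $\mathbf 1_{\mathcal P}$ of the set $\mathcal P=\{2,3,5,7,\dots\}$ of primes is not a bracket word.
   Context: $\mathbb N_0=\{0,1,2,\dots\}$. For $E\subset\mathbb N_0$, $\mathbf 1_E\in\{0,1\}^\infty$ is the word with $(\mathbf 1_E)_n=1$ if $n\in E$ and $0$ otherwise ($n\in\mathbb N_0$). Generalised polynomial (GP) maps $\mathbb R\to\mathbb R$ form the smallest family of maps that contains all polynomial maps $\mathbb R\to\mathbb R$ (with real coefficients), is closed under sums and products, and contains $\lfloor g\rfloor$ whenever it contains $g$. A GP map $\mathbb N_0\to\mathbb R$ is the restriction to $\mathbb N_0$ of such a map. A bracket word over a finite alphabet $\Sigma$ is an infinite word $\mathbf a=(a_n)_{n=0}^\infty\in\Sigma^\infty$ of the form $a_n=c(g(n))$ for all $n\in\mathbb N_0$, where $g\colon\mathbb N_0\to\mathbb R$ is a finitely-valued GP map and $c\colon g(\mathbb N_0)\to\Sigma$ is an arbitrary map. *)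

(* Defs.v *)
From mathcomp Require Import all_boot all_order all_algebra.
From mathcomp Require Import all_classical all_reals.

Set Implicit Arguments.
Unset Strict Implicit.
Unset Printing Implicit Defensive.

Import Order.TTheory GRing.Theory Num.Theory.

Local Open Scope classical_set_scope.
Local Open Scope ring_scope.

Inductive gp_map (R : realType) : (R -> R) -> Prop :=
| gp_poly (p : {poly R}) : gp_map (fun x => p.[x])
| gp_add (g h : R -> R) : gp_map g -> gp_map h -> gp_map (fun x => g x + h x)
| gp_mul (g h : R -> R) : gp_map g -> gp_map h -> gp_map (fun x => g x * h x)
| gp_floor (g : R -> R) : gp_map g -> gp_map (fun x => (Num.floor (g x))%:~R).

Definition gp_map_nat (R : realType) (g : nat -> R) : Prop :=
  exists2 h : R -> R, gp_map h & forall n : nat, g n = h n%:R.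

(* The coding map c is taken total on R: only its values on range g matter, and
   since range g is nonempty every map range g -> Sigma extends to R. *)
Definition bracket_word (R : realType) (Sigma : finType) (a : nat -> Sigma) :
    Prop :=
  exists (g : nat -> R) (c : R -> Sigma),
    [/\ gp_map_nat g, finite_set (range g) & forall n : nat, a n = c (g n)].

(* The alphabet {0, 1} is bool. *)
Definition char_word (E : set nat) : nat -> bool := fun n => n \in E.

(* Main.v *)
Require Import Defs.
From HB Require Import structures.
From mathcomp Require Import all_boot all_order all_algebra.
From mathcomp Require Import all_classical all_reals.
From mathcomp Require Import zify lra.

(** The number of words of length [N] that occur in a word is its complexity.
    A bracket word has complexity at most polynomial in [N], while that of the
    characteristic word of the primes exceeds every polynomial.

    For the upper bound, a polynomial restricted to [x, x + 1, ..., x + N - 1]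
    is a combination of the functions [m ^ i] with real coefficients depending
    on [x].  More generally a generalised polynomial is, on each such window, a
    real combination of boundedly many integer-valued functions of polynomial
    size, chosen from a list of polynomial length ([gp_map_locally_combs]).
    The step that matters is the floor: integer parts of the coefficients
    leave the floor, and then coefficients in [[0, 1]] matter only through the
    position of the values relative to polynomially many integers, that is,
    through the cell of a hyperplane arrangement in a space of fixed dimension.
    Such an arrangement has polynomially many cells ([count_signs]).  The same
    count, applied to the finitely many values of the map, bounds the
    complexity of bracket words ([bracket_word_complexity]).

    For the lower bound ([prime_words_superpolynomial]), suppose that the
    patterns of primes in the windows of length [N] form a list [s] of
    polynomial length.  Let [X] be the product of the primes up to [z], where
    [z] is a small power of [N], so that [log X] is about [z].  By Chebyshev
    primes have density at least about [1 / log X] below [X], hence on average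
    a window below [X] contains about [N / log X] primes, and many windows
    contain [k] of them or more, where [k] is a still smaller power of [N].
    But for a fixed pattern with [k] ones, a window starting at some [x > z] has
    this pattern only if [x] avoids, for almost all primes [p <= z], [k] residue
    classes modulo [p].  By the Chinese remainder theorem this happens with
    density about [exp (- k * pi(z) / z)], too small even when summed over all
    patterns in [s]. *)

Set Implicit Arguments.
Unset Strict Implicit.
Unset Printing Implicit Defensive.

Import Order.TTheory GRing.Theory Num.Theory.

Lemma leq_expn2 m n e : m <= n -> m ^ e <= n ^ e.
Proof. by case: e => [|e] le_mn //; rewrite leq_exp2r. Qed.

Local Open Scope ring_scope.

(** * Sign patterns of linear functionals *)

Definition signs (R : realFieldType) (V : vectType R) (fs : seq 'Hom(V, R^o))
  (u : V) : seq bool := [seq (f u : R) < 0 | f : 'Hom(V, R^o) <- fs].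

(** The half-lines of negative and of nonnegative reals are both convex cones,
    so a sign pattern shared by two points persists between them. *)
Lemma signs_segment (R : realFieldType) (V : vectType R)
    (fs : seq 'Hom(V, R^o)) (u v : V) (a b : R) :
  0 < a -> 0 <= b -> signs fs u = signs fs v ->
  signs fs (a *: u + b *: v) = signs fs u.
Proof.
move=> a_gt0 b_ge0; elim: fs => //= f fs IHfs [eq_f /IHfs ->]; congr (_ :: _).
rewrite linearD !linearZ /= -[_ *: _]/(a * f u) -[b *: _]/(b * f v).
move: eq_f; case: ltP => u_sgn /esym; case: ltP => // v_sgn _.
  by nra.
by apply/negbTE; rewrite -leNgt; nra.
Qed.

Lemma leq_add_expn k d e : (0 < k -> d < e -> k ^ e + k ^ d <= k.+1 ^ e)%N.
Proof.
move=> k_gt0; case: e => // e; rewrite ltnS => le_de.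
apply: (@leq_trans (k ^ e * k.+1)%N); last by rewrite expnSr leq_mul ?leq_expn2.
by rewrite mulnS addnC -expnSr leq_add2r leq_pexp2l.
Qed.

(** A hyperplane arrangement has polynomially many cells when the dimension is
    fixed.  By induction on the functionals: if both signs of a new functional
    [f] occur together with one pattern of the old ones, then by
    [signs_segment] that pattern also occurs on the kernel of [f].  So [f] adds
    at most as many patterns as the old functionals have on [U :&: lker f], of
    dimension one less. *)
Lemma count_signs (R : realFieldType) (V : vectType R)
    (fs : seq 'Hom(V, R^o)) (U : {vspace V}) :
  exists2 s : seq (seq bool), (size s <= (size fs).+1 ^ \dim U)%N &
    forall u, u \in U -> signs fs u \in s.
Proof.
elim: fs U => [|f fs IHfs] U.
  by exists [:: [::]] => [|u _]; rewrite ?exp1n // inE.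
have [s0 s0_size s0P] := IHfs U.
case: (boolP (U <= lker f)%VS) => [/subvP U_ker|U_ker].
  exists [seq false :: p | p <- s0] => [|u uU].
    by rewrite size_map (leq_trans s0_size) // leq_expn2.
  have /U_ker := uU; rewrite memv_ker => /eqP fu.
  by rewrite /signs /= fu ltxx map_f // s0P.
have [s1 s1_size s1P] := IHfs (U :&: lker f)%VS.
(* [b p] is a sign of [f] that occurs together with [p], the negative one when
   both do. *)
pose b p := `[< exists u, [/\ u \in U, (f u : R) < 0 & signs fs u = p] >].
exists ([seq b p :: p | p <- s0] ++ [seq ~~ b p :: p | p <- s1]).
  rewrite size_cat !size_map; apply: leq_trans (leq_add s0_size s1_size) _.
  have dimE := limg_ker_dim f U.
  have img_gt0 : (0 < \dim (f @: U))%N.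
    rewrite lt0n dimv_eq0; apply: contraNN U_ker => /eqP fU0.
    by rewrite lkerE fU0.
  apply: leq_add_expn => //.
  by rewrite -dimE -[X in (X < _)%N]addn0 ltn_add2l.
move=> u uU; rewrite mem_cat; set p := signs fs u.
have -> : signs (f :: fs) u = ((f u : R) < 0) :: p by [].
case: (eqVneq (b p) ((f u : R) < 0)) => [<-|neq_b].
  by rewrite map_f ?s0P.
have fu_ge0 : 0 <= (f u : R).
  rewrite leNgt; apply: contraNN neq_b => fu; rewrite fu.
  by apply/eqP/asboolP; exists u.
move: neq_b; rewrite ltNge fu_ge0 /=; case: (boolP (b p)) => // bp _.
have /asboolP[v [vU fv_lt0 eq_p]] := bp.
apply/orP; right; rewrite -[false]/(~~ true) -bp map_f //.
have fv_gt0 : 0 < - (f v : R) by rewrite oppr_gt0.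
rewrite /p -(signs_segment fv_gt0 fu_ge0 (esym eq_p)); apply: s1P.
rewrite memv_cap memvD ?memvZ //= memv_ker linearD !linearZ /=.
rewrite -[_ *: _]/(- (f v : R) * (f u : R)).
by rewrite -[_ *: f v]/((f u : R) * (f v : R)) mulNr mulrC addNr.
Qed.

(** * Levels of integer combinations *)

Definition comb (R : realFieldType) (I : finType) (w : I -> nat -> int)
  (a : I -> R) (m : nat) : R := \sum_i a i * (w i m)%:~R.

Definition dual_form (R : realFieldType) (J : finType) (c : J -> R)
  (v : {ffun J -> R^o}) : R^o := \sum_j (v j : R) * c j.

Fact dual_form_linear (R : realFieldType) (J : finType) (c : J -> R) :
  linear (dual_form c).
Proof.
move=> k u v; rewrite /dual_form scaler_sumr -big_split /=.
by apply: eq_bigr => j _; rewrite !ffunE mulrDl -mulrA.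
Qed.

HB.instance Definition _ (R : realFieldType) (J : finType) (c : J -> R) :=
  GRing.isLinear.Build R {ffun J -> R^o} R^o _ (dual_form c)
    (dual_form_linear c).

(** For fixed integer functions [w i], finitely many coefficient vectors [r j],
    polynomially many in the number of thresholds and sample points, represent
    all vectors with property [P] as far as comparisons of the combination with
    the thresholds go.  These comparisons are signs of linear functionals on
    [R^(1 + I)], the additional coordinate, set to [1], carrying the threshold;
    the exponent [D] depends on [I] only. *)
Lemma level_representatives (R : realType) (I : finType) :
  exists D : nat, forall (w : I -> nat -> int) (T : seq R) (N : nat)
      (P : (I -> R) -> Prop),
    exists r : 'I_((N * size T).+1 ^ D) -> I -> R,
      forall b, P b -> exists j, P (r j) /\
        forall m t, (m < N)%N -> t \in T ->
          (comb w b m < t) = (comb w (r j) m < t).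
Proof.
pose V : vectType R := {ffun 'I_1 + I -> R^o}.
exists (\dim {:V}) => w T N P.
pose c (mt : nat * R) (j : 'I_1 + I) : R :=
  if j is inr i then (w i mt.1)%:~R else - mt.2.
pose mts := [seq (m, t) | m <- iota 0 N, t <- T].
pose fs : seq 'Hom(V, R^o) := [seq linfun (dual_form (c mt)) | mt <- mts].
pose vec (b : I -> R) : V := [ffun j => if j is inr i then b i else 1].
have [s s_size sP] := count_signs fs fullv.
have {}s_size : (size s <= (N * size T).+1 ^ \dim {:V})%N.
  by move: s_size; rewrite size_map size_allpairs size_iota.
pose rep (p : seq bool) (b : I -> R) := P b /\ signs fs (vec b) = p.
exists (fun j => xget (fun=> 0) (rep (nth [::] s j))) => b Pb.
have in_s : signs fs (vec b) \in s by rewrite sP ?memvf.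
have lt_j := leq_trans (etrans (index_mem _ _) in_s) s_size.
exists (Ordinal lt_j) => /=; rewrite nth_index //.
have [_ ->|/(_ b)[]] := xgetP; last by [].
move=> [Pr eq_signs]; split=> // m t lt_m tT.
have fE a : (linfun (dual_form (c (m, t))) (vec a) : R) = comb w a m - t.
  rewrite lfunE /= /dual_form big_sumType big_ord1 /= ffunE mul1r addrC.
  congr (_ + _).
  by apply: eq_bigr => i _; rewrite ffunE.
have mt_in : (m, t) \in mts by rewrite allpairs_f ?mem_iota.
have := congr1 (nth false ^~ (index (m, t) mts)) eq_signs.
have lt_i : (index (m, t) mts < size mts)%N by rewrite index_mem.
rewrite /signs /fs -!map_comp !(nth_map (m, t)) // nth_index //=.
by rewrite !fE !subr_lt0 => ->.
Qed.

(** * Generalised polynomials on windows *)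

(** The base [N + 2] is at least [2] for every [N], so that its powers exceed
    any given constant. *)
Definition poly_growth (f : nat -> nat) : Prop :=
  exists C, forall N, (f N <= (N + 2) ^ C)%N.

Lemma poly_growth_cst c : poly_growth (fun=> c).
Proof.
exists c => N; apply: leq_trans (ltnW (ltn_expl c (ltnSn 1))) _.
by rewrite leq_expn2 // leq_addl.
Qed.

Lemma poly_growth_id : poly_growth id.
Proof. by exists 1%N => N; rewrite expn1 leq_addr. Qed.

Lemma poly_growthM f g :
  poly_growth f -> poly_growth g -> poly_growth (fun N => f N * g N)%N.
Proof.
by move=> [C fC] [D gD]; exists (C + D)%N => N; rewrite expnD leq_mul.
Qed.

Lemma poly_growthD f g :
  poly_growth f -> poly_growth g -> poly_growth (fun N => f N + g N)%N.
Proof.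
move=> [C fC] [D gD]; exists (C + D).+1 => N.
have N2_gt0 : (0 < N + 2)%N by rewrite addn2.
apply: leq_trans (leq_add (fC N) (gD N)) _; rewrite expnS.
have leC : ((N + 2) ^ C <= (N + 2) ^ (C + D))%N by rewrite leq_pexp2l ?leq_addr.
have leD : ((N + 2) ^ D <= (N + 2) ^ (C + D))%N by rewrite leq_pexp2l ?leq_addl.
by move: leC leD; set c := (_ ^ (C + D))%N; nia.
Qed.

Lemma poly_growthX f e : poly_growth f -> poly_growth (fun N => f N ^ e)%N.
Proof.
by move=> [C fC]; exists (C * e)%N => N; rewrite expnM leq_expn2.
Qed.

(** The invariant carried through the construction of generalised polynomials.
    On every window [x, x + 1, ..., x + N - 1] the map is a real linear
    combination of integer-valued functions [w k i], whose number does not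
    depend on [N]; these have size polynomial in [N], and the family [w k] is
    one of polynomially many.  The real coefficients [a] vary with the window
    and are not bounded at all: this is why the invariant can hold for
    unbounded maps, and it survives multiplication because all counting
    concerns the integer-valued functions alone. *)
Definition locally_combs (R : realType) (h : R -> R) : Prop :=
  exists (I : finType) (f : nat -> nat), poly_growth f /\ forall N : nat,
    exists (K : finType) (w : K -> I -> nat -> int),
      [/\ (#|K| <= f N)%N,
          forall k i m, (m < N)%N -> (`|w k i m| <= f N)%N &
          forall x : R, exists k a, forall m, (m < N)%N ->
            h (x + m%:R) = comb (w k) a m].

Lemma locally_combs_poly (R : realType) (p : {poly R}) :
  locally_combs (fun x => p.[x]).
Proof.
exists 'I_(size p), (fun N => (N + 1) ^ (size p))%N; split.
  apply/poly_growthX/poly_growthD; first exact: poly_growth_id.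
  exact: poly_growth_cst.
move=> N; exists unit, (fun _ (i : 'I_(size p)) m => (m ^ i)%N%:Z); split.
- by rewrite card_unit expn_gt0 addn1.
- move=> _ i m lt_m; rewrite absz_nat; apply: (@leq_trans ((N + 1) ^ i)%N).
    by rewrite leq_expn2 // addn1 ltnW // ltnW.
  by rewrite leq_pexp2l ?addn1 // ltnW.
move=> x; exists tt, (fun i : 'I_(size p) => (p \Po ('X + x%:P))`_i) => m _.
have -> : p.[x + m%:R] = (p \Po ('X + x%:P)).[m%:R].
  by rewrite horner_comp !hornerE addrC.
rewrite horner_coef size_comp_poly2 ?size_XaddC // /comb.
by apply: eq_bigr => i _; rewrite -natrX.
Qed.

Lemma locally_combsD (R : realType) (g h : R -> R) :
  locally_combs g -> locally_combs h -> locally_combs (fun x => g x + h x).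
Proof.
move=> [I [f [f_pg gP]]] [J [f' [f'_pg hP]]].
exists (I + J)%type, (fun N => f N * f' N + (f N + f' N))%N; split.
  by apply: poly_growthD; [exact: poly_growthM|exact: poly_growthD].
move=> N; have [K [w [K_le w_le gw]]] := gP N.
have [L [v [L_le v_le hv]]] := hP N.
exists (K * L)%type, (fun kl ij =>
  match ij with inl i => w kl.1 i | inr j => v kl.2 j end); split.
- by rewrite card_prod (leq_trans (leq_mul K_le L_le)) // leq_addr.
- move=> [k l] [i|j] m lt_m /=.
    by apply: leq_trans (w_le _ _ _ lt_m) _; lia.
  by apply: leq_trans (v_le _ _ _ lt_m) _; lia.
move=> x; have [k [a ga]] := gw x; have [l [b hb]] := hv x.
exists (k, l), (fun ij => match ij with inl i => a i | inr j => b j end).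
by move=> m lt_m; rewrite ga // hb // /comb big_sumType.
Qed.

Lemma locally_combsM (R : realType) (g h : R -> R) :
  locally_combs g -> locally_combs h -> locally_combs (fun x => g x * h x).
Proof.
move=> [I [f [f_pg gP]]] [J [f' [f'_pg hP]]].
exists (I * J)%type, (fun N => f N * f' N)%N; split; first exact: poly_growthM.
move=> N; have [K [w [K_le w_le gw]]] := gP N.
have [L [v [L_le v_le hv]]] := hP N.
exists (K * L)%type, (fun kl ij m => w kl.1 ij.1 m * v kl.2 ij.2 m).
split.
- by rewrite card_prod leq_mul.
- by move=> [k l] [i j] m lt_m /=; rewrite abszM leq_mul ?w_le ?v_le.
move=> x; have [k [a ga]] := gw x; have [l [b hb]] := hv x.
exists (k, l), (fun ij => a ij.1 * b ij.2) => m lt_m.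
rewrite ga // hb // /comb big_distrlr pair_big /=.
by apply: eq_bigr => ij _; rewrite intrM mulrACA.
Qed.

Lemma eq_floor_levels (R : realType) (B : nat) (y y' : R) :
    `|y| <= B%:R -> `|y'| <= B%:R ->
    (forall t, t \in [seq (k%:Z - B%:Z)%:~R | k <- iota 0 B.*2.+1] ->
      (y < t) = (y' < t)) ->
  Num.floor y = Num.floor y'.
Proof.
wlog suff le_floor : y y' / `|y| <= B%:R -> `|y'| <= B%:R ->
    (forall t : R, t \in [seq (k%:Z - B%:Z)%:~R | k <- iota 0 B.*2.+1] ->
      (y < t) = (y' < t)) -> Num.floor y <= Num.floor y'.
  move=> le_y le_y' eq_t; apply/eqP; rewrite eq_le !le_floor //.
  by move=> t tT; rewrite eq_t.
rewrite !ler_norml => /andP[y_ge y_le] _ eq_t.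
have [k kE] : exists k : nat, Num.floor y = k%:Z - B%:Z /\ (k < B.*2.+1)%N.
  have : - B%:Z <= Num.floor y by rewrite floor_ge_int intrN.
  have : Num.floor y <= B%:Z by rewrite -(ler_int R) (le_trans (floor_le _)).
  by move: (Num.floor y) => n; exists (absz (n + B%:Z)); lia.
rewrite kE.1 floor_ge_int leNgt -eq_t -?leNgt -?floor_ge_int ?kE.1 //.
by apply/mapP; exists k; rewrite // mem_iota kE.2.
Qed.

Lemma comb_norm_le (R : realType) (I : finType) (w : I -> nat -> int)
    (a : I -> R) (m M : nat) :
    (forall i, 0 <= a i <= 1) -> (forall i, (`|w i m| <= M)%N) ->
  `|comb w a m| <= (#|I| * M)%:R.
Proof.
move=> a01 w_le; apply: le_trans (ler_norm_sum _ _ _) _.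
apply: (@le_trans _ _ (\sum_(i : I) M%:R)); last first.
  by rewrite sumr_const natrM mulr_natl.
apply: ler_sum => i _; have /andP[a_ge0 a_le1] := a01 i.
rewrite normrM ger0_norm // -[leRHS]mul1r ler_pM //.
by rewrite -intr_norm -abszE -pmulrn ler_nat w_le.
Qed.

Lemma absz_floor_le (R : realType) (y : R) (B : nat) :
  `|y| <= B%:R -> (`|Num.floor y| <= B)%N.
Proof.
rewrite ler_norml => /andP[y_ge y_le].
have : - B%:Z <= Num.floor y by rewrite floor_ge_int intrN.
have : Num.floor y <= B%:Z by rewrite -(ler_int R) (le_trans (floor_le _)).
lia.
Qed.

(** Splitting each coefficient into integer and fractional part, the integer
    parts contribute an integer-valued combination of the same [w k i], which
    leaves the floor.  What is left is the floor of a combination with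
    coefficients in [[0, 1]], an integer of polynomial size determined by its
    comparisons with polynomially many integer thresholds; so
    [level_representatives] leaves polynomially many possibilities for it, and
    it can be adjoined as one more integer-valued function. *)
Lemma locally_combs_floor (R : realType) (h : R -> R) :
  locally_combs h -> locally_combs (fun x => (Num.floor (h x))%:~R).
Proof.
move=> [I [f [f_pg hP]]]; have [D repP] := level_representatives R I.
pose B N := (#|I| * f N)%N.
pose L N := ((N * (B N).*2.+1).+1 ^ D)%N.
have B_pg : poly_growth B by apply: poly_growthM => //; exact: poly_growth_cst.
have L_pg : poly_growth L.
  apply: poly_growthX; have -> : (fun N => (N * (B N).*2.+1).+1) =
      (fun N => 1 + N * (1 + 2 * B N))%N by apply/funext => N; lia.
  apply: poly_growthD; first exact: poly_growth_cst.
  apply: poly_growthM; first exact: poly_growth_id.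
  apply: poly_growthD; first exact: poly_growth_cst.
  by apply: poly_growthM => //; exact: poly_growth_cst.
exists ('I_1 + I)%type, (fun N => f N * L N + (f N + B N))%N; split.
  by apply: poly_growthD; [exact: poly_growthM|exact: poly_growthD].
move=> N; have [K [w [K_le w_le hw]]] := hP N.
pose T : seq R := [seq (k%:Z - (B N)%:Z)%:~R | k <- iota 0 (B N).*2.+1].
have sizeT : size T = (B N).*2.+1 by rewrite size_map size_iota.
pose frac_coefs (b : I -> R) := forall i, 0 <= b i <= 1.
have rep_k k : exists r : 'I_(L N) -> I -> R, forall b, frac_coefs b ->
    exists j, frac_coefs (r j) /\ forall m t, (m < N)%N -> t \in T ->
          (comb (w k) b m < t) = (comb (w k) (r j) m < t).
  by have := repP (w k) T N frac_coefs; rewrite sizeT.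
have [r rP] := choice rep_k.
pose v k j m := if `[< frac_coefs (r k j) >]
  then Num.floor (comb (w k) (r k j) m) else 0.
have comb_le k b m : (m < N)%N -> frac_coefs b -> `|comb (w k) b m| <= (B N)%:R.
  by move=> lt_m b01; apply: comb_norm_le => // i; exact: w_le.
exists (K * 'I_(L N))%type, (fun kj ij m =>
  match ij with inl _ => v kj.1 kj.2 m | inr i => w kj.1 i m end); split.
- by rewrite card_prod card_ord (leq_trans (leq_mul K_le (leqnn _))) ?leq_addr.
- move=> [k j] [_|i] m lt_m /=; last first.
    by apply: leq_trans (w_le k i m lt_m) _; lia.
  apply: (@leq_trans (B N)); last by lia.
  rewrite /v; case: asboolP => // r01.
  by apply: absz_floor_le; exact: comb_le.
move=> x; have [k [a ha]] := hw x.
pose b i := a i - (Num.floor (a i))%:~R.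
have b01 : frac_coefs b.
  by move=> i; have := floor_itv (a i); rewrite /b intrD; lra.
have [j [r01 eq_lt]] := rP k b b01.
exists (k, j), (fun ij =>
  match ij with inl _ => 1 | inr i => (Num.floor (a i))%:~R end).
move=> m lt_m; rewrite ha // /comb big_sumType big_ord1 /= mul1r /v asboolT //.
have -> : \sum_i a i * (w k i m)%:~R =
    comb (w k) b m + (\sum_i Num.floor (a i) * w k i m)%:~R.
  rewrite rmorph_sum -big_split; apply: eq_bigr => i _ /=.
  by rewrite rmorphM -mulrDl subrK.
rewrite floorDrz ?intr_int // intrKfloor intrD.
rewrite (eq_floor_levels (B := B N) (y' := comb (w k) (r k j) m)) ?comb_le //.
  by congr (_ + _); rewrite rmorph_sum; apply: eq_bigr => i _; rewrite rmorphM.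
by move=> t; exact: eq_lt.
Qed.

Lemma gp_map_locally_combs (R : realType) (h : R -> R) :
  gp_map h -> locally_combs h.
Proof.
elim=> {h} [p|g h _ gP _ hP|g h _ gP _ hP|g _ gP].
- exact: locally_combs_poly.
- exact: locally_combsD.
- exact: locally_combsM.
- exact: locally_combs_floor.
Qed.

(** * Complexity of bracket words *)

(** Since [g] has finitely many values, its values on a window are determined
    by comparing the local combination with these values, and
    [level_representatives] applies once more. *)
Theorem bracket_word_complexity (R : realType) (Sigma : finType)
    (a : nat -> Sigma) :
  bracket_word R a -> exists C, forall N, exists s : seq (seq Sigma),
    (size s <= (N + 2) ^ C)%N /\
    forall n, mkseq (fun m => a (n + m)%N) N \in s.
Proof.
move=> [g [c [[h h_gp gE] /finite_seqP[T TE] aE]]].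
have [I [f [f_pg hP]]] := gp_map_locally_combs h_gp.
have [D repP] := level_representatives R I.
have [C leC] : poly_growth (fun N => f N * (N * size T).+1 ^ D)%N.
  apply: poly_growthM => //; apply: poly_growthX.
  have -> : (fun N => (N * size T).+1) = (fun N => 1 + N * size T)%N by [].
  apply: poly_growthD; first exact: poly_growth_cst.
  by apply: poly_growthM; [exact: poly_growth_id|exact: poly_growth_cst].
exists C => N; have [K [w [K_le _ hw]]] := hP N.
pose valued k (b : I -> R) := forall m, (m < N)%N -> comb (w k) b m \in T.
have [r rP] := choice (fun k => repP (w k) T N (valued k)).
exists [seq mkseq (fun m => c (comb (w k) (r k j) m)) N |
  k <- enum K, j <- enum 'I_((N * size T).+1 ^ D)]; split.
  rewrite size_allpairs -!cardE card_ord.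
  by apply: leq_trans (leC N); rewrite leq_mul.
move=> n; have [k [b hb]] := hw n%:R.
have gb m : (m < N)%N -> g (n + m)%N = comb (w k) b m.
  by move=> lt_m; rewrite gE natrD hb.
have gT m : g m \in T.
  have : range g (g m) by exists m.
  by rewrite TE.
have b_valued : valued k b by move=> m lt_m; rewrite -gb.
have [j [r_T eq_lt]] := rP k b b_valued.
have -> : mkseq (fun m => a (n + m)%N) N =
    mkseq (fun m => c (comb (w k) (r k j) m)) N.
  apply/eq_in_map => m; rewrite mem_iota => /andP[_ lt_m].
  rewrite aE gb //; congr c.
  have bT := b_valued m lt_m; have rT := r_T m lt_m.
  (* Both numbers lie in [T], so each may serve as a threshold for the other. *)
  apply/eqP; rewrite eq_le !leNgt -(eq_lt _ _ lt_m bT).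
  by rewrite (eq_lt _ _ lt_m rT) !ltxx.
by apply: allpairs_f; rewrite mem_enum.
Qed.

Local Close Scope ring_scope.

(** * Chebyshev's bound *)

Lemma prime_dvd_fact p n : prime p -> (p %| n`!) = (p <= n).
Proof.
move=> p_pr; apply/idP/idP => [|le_pn]; last first.
  by rewrite dvdn_fact // prime_gt0.
elim: n => [|n IHn]; first by rewrite dvdn1 => /eqP p1; rewrite p1 in p_pr.
by rewrite factS Euclid_dvdM // => /orP[/dvdn_leq-> //|/IHn/leqW].
Qed.

Lemma expn2_le_central_bin n : 2 ^ n <= 'C(n.*2, n).
Proof.
elim: n => [|n IHn] //.
have le_C : 'C(n.*2, n) <= 'C(n.*2.+1, n) by apply: leq_bin2l.
rewrite doubleS binS [X in X + _]binS expnS.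
by move: IHn le_C; set c := 'C(_, _); lia.
Qed.

(** Legendre's formula: each prime power [p ^ k <= 2 n] contributes at most one
    to the exponent of [p] in the central binomial coefficient, and larger ones
    contribute nothing. *)
Lemma leq_pfactor_central_bin n p :
  0 < n -> prime p -> p ^ logn p 'C(n.*2, n) <= n.*2.
Proof.
move=> n_gt0 p_pr; have p_gt1 := prime_gt1 p_pr.
have n2_gt0 : 0 < n.*2 by rewrite double_gt0.
have le_n : n <= n.*2 by rewrite -addnn leq_addr.
apply: leq_trans (trunc_logP p_gt1 n2_gt0); rewrite leq_exp2l //.
have C_gt0 : 0 < 'C(n.*2, n) by rewrite bin_gt0.
have logE : logn p 'C(n.*2, n) + (logn p n`!).*2 = logn p (n.*2)`!.
  have n2B : n.*2 - n = n by rewrite -addnn addnK.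
  rewrite -(bin_fact le_n) n2B.
  by rewrite !lognM ?muln_gt0 ?fact_gt0 ?C_gt0 // addnn.
have fact_n : logn p n`! = \sum_(1 <= k < n.*2.+1) n %/ p ^ k.
  rewrite (logn_fact n p_pr) [RHS](@big_cat_nat _ _ _ n.+1) //=.
  rewrite [X in _ = _ + X]big1_seq ?addn0 // => k; rewrite mem_index_iota.
  move=> /andP[_ /andP[lt_nk _]]; rewrite divn_small //.
  by apply: leq_trans lt_nk (ltnW (ltn_expl _ _)).
have : logn p (n.*2)`! <=
    (logn p n`!).*2 + \sum_(1 <= k < n.*2.+1) (k <= trunc_log p n.*2).
  rewrite fact_n (logn_fact n.*2 p_pr) -[(\sum_(_ <= _ < _) _).*2]mul2n.
  rewrite big_distrr -big_split /=.
  apply: leq_sum => k _; have [le_k|lt_k] := leqP k.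
    by rewrite mul2n -!addnn leq_divDl.
  rewrite divn_small //; apply: leq_trans (trunc_log_ltn _ p_gt1) _.
  by rewrite leq_exp2l.
have -> : \sum_(1 <= k < n.*2.+1) (k <= trunc_log p n.*2) = trunc_log p n.*2.
  have le_t : trunc_log p n.*2 <= n.*2.
    apply: leq_trans (trunc_logP p_gt1 n2_gt0).
    exact: ltnW (ltn_expl _ p_gt1).
  rewrite (@big_cat_nat _ _ _ (trunc_log p n.*2).+1) //=.
  rewrite [X in _ + X]big1_seq ?addn0; last first.
    by move=> k; rewrite mem_index_iota => /andP[_ /andP[]]; case: leqP.
  rewrite (eq_big_nat _ _ (F2 := fun=> 1)); last by move=> k; case: leqP; lia.
  by rewrite sum_nat_const_nat; lia.
by lia.
Qed.

(** Chebyshev's lower bound for the number of primes: the central binomial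
    coefficient is at least [2 ^ n], only primes up to [2 n] divide it, and
    each contributes a factor of at most [2 n]. *)
Lemma chebyshev n :
  0 < n -> 2 ^ n <= n.*2 ^ count prime (iota 0 n.*2.+1).
Proof.
move=> n_gt0; apply: leq_trans (expn2_le_central_bin n) _.
have le_n : n <= n.*2 by rewrite -addnn leq_addr.
have C_gt0 : 0 < 'C(n.*2, n) by rewrite bin_gt0.
rewrite [X in X <= _](prod_prime_decomp C_gt0) prime_decompE big_map /=.
apply: (@leq_trans (\prod_(p <- primes 'C(n.*2, n)) n.*2)).
  rewrite big_seq [leqRHS]big_seq; apply: leq_prod => p.
  rewrite mem_primes => /andP[p_pr _].
  exact: leq_pfactor_central_bin.
rewrite big_const_seq count_predT iter_muln_1 -size_filter.
rewrite leq_pexp2l ?double_gt0 //; apply: uniq_leq_size => [|p].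
  exact: primes_uniq.
rewrite mem_primes mem_filter mem_iota => /and3P[p_pr _ p_dvd].
rewrite p_pr prime_gt0 //= add1n ltnS -(prime_dvd_fact _ p_pr).
apply: dvdn_trans p_dvd _.
by rewrite -(bin_fact le_n) dvdn_mulr.
Qed.

Lemma chebyshev_expn2 n m : 0 < n -> ~~ odd n -> n <= 2 ^ m ->
  n <= 2 * m * count prime (iota 0 n.+1).
Proof.
move=> n_gt0 even_n le_nm.
have h_gt0 : 0 < n./2.
  by rewrite half_gt0; case: n n_gt0 even_n {le_nm} => [|[]].
have := chebyshev h_gt0; rewrite even_halfK //; set c := count _ _ => le_n.
have : n./2 <= m * c.
  rewrite -(leq_exp2l _ _ (ltnSn 1)); apply: leq_trans le_n _.
  by rewrite expnM leq_expn2.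
by have := even_halfK even_n; lia.
Qed.

Lemma expn2_size_primes d : 0 < d -> 2 ^ size (primes d) <= d.
Proof.
move=> d_gt0; rewrite [X in _ <= X](prod_prime_decomp d_gt0) prime_decompE.
rewrite big_map /= -iter_muln_1 -[size _]count_predT -big_const_seq.
rewrite big_seq [leqRHS]big_seq; apply: leq_prod => p p_d.
have e_gt0 : 0 < logn p d by rewrite logn_gt0.
have p_gt1 : 1 < p by move: p_d; rewrite mem_primes => /andP[/prime_gt1].
by rewrite (leq_trans p_gt1) // -[X in X <= _]expn1 leq_pexp2l // ltnW.
Qed.

(** * A sieve over a full period *)

(** Only the injective half of the Chinese remainder theorem is at work. *)
Lemma count_crt d e (F G : pred nat) : 0 < d -> 0 < e -> coprime d e ->
  count (fun x => F (x %% d) && G (x %% e)) (iota 0 (d * e)) <=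
  count F (iota 0 d) * count G (iota 0 e).
Proof.
move=> d_gt0 e_gt0 co_de; rewrite -!size_filter -(size_allpairs pair).
rewrite -(size_map (fun x => (x %% d, x %% e))); apply: uniq_leq_size.
  rewrite map_inj_in_uniq ?filter_uniq ?iota_uniq // => x y.
  rewrite !mem_filter !mem_iota /= => /andP[_ lt_x] /andP[_ lt_y] [eq_d eq_e].
  have /eqP : x == y %[mod d * e].
    by rewrite chinese_remainder // eq_d eq_e !eqxx.
  by rewrite !modn_small.
move=> u /mapP[x]; rewrite mem_filter => /andP[/andP[Fx Gx] _] ->.
by apply: allpairs_f; rewrite mem_filter ?Fx ?Gx mem_iota ltn_mod.
Qed.

Lemma count_sieve (ps : seq nat) (G : nat -> pred nat) :
    uniq ps -> all prime ps ->
  count (fun x => all (fun p => G p (x %% p)) ps)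
        (iota 0 (\prod_(p <- ps) p)) <=
  \prod_(p <- ps) count (G p) (iota 0 p).
Proof.
elim: ps => [|p ps IHps] /=; first by rewrite !big_nil.
case/andP=> p_ps uniq_ps /andP[p_pr prime_ps]; rewrite !big_cons.
set d := \prod_(q <- ps) q in IHps *.
have p_gt0 := prime_gt0 p_pr.
have d_gt0 : 0 < d.
  rewrite /d big_seq prodn_cond_gt0 // => q q_ps.
  by rewrite prime_gt0 ?(allP prime_ps).
have dvd_d q : q \in ps -> q %| d.
  by move=> q_ps; rewrite /d (big_rem q) ?dvdn_mulr.
have co_pd : coprime p d.
  rewrite /d big_seq; elim/big_ind: _ => [|a b|q q_ps].
  - exact: coprimen1.
  - by rewrite coprimeMr => -> ->.
  rewrite prime_coprime // dvdn_prime2 ?(allP prime_ps q) //.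
  by apply: contraNN p_ps => /eqP->.
pose F x := all (fun q => G q (x %% q)) ps.
apply: (@leq_trans (count (G p) (iota 0 p) * count F (iota 0 d))); last first.
  by rewrite leq_mul2l (IHps uniq_ps prime_ps) orbT.
apply: leq_trans (count_crt (G p) _ p_gt0 d_gt0 co_pd).
apply: sub_count => x /= /andP[-> /allP allx] /=; apply/allP => q q_ps.
by rewrite modn_dvdm ?dvd_d ?allx.
Qed.

Lemma count_avoiding p (H : seq nat) :
    0 < p -> uniq [seq h %% p | h <- H] ->
  count (fun y => all (fun h => ~~ (p %| y + h)) H) (iota 0 p) <= p - size H.
Proof.
move=> p_gt0 uniq_H; set P := fun y => _.
suff le_H : size H <= count (predC P) (iota 0 p).
  by have := count_predC P (iota 0 p); rewrite size_iota; lia.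
(* The residues [- h] modulo [p] are distinct, and none of them is counted. *)
pose opp r := (p - r) %% p.
rewrite -size_filter -(size_map (fun h => opp (h %% p))); apply: uniq_leq_size.
  rewrite (map_comp opp) map_inj_in_uniq // => r s.
  have lt_p u : u \in [seq h %% p | h <- H] -> u < p.
    by case/mapP=> h _ ->; rewrite ltn_mod.
  move=> /lt_p lt_r /lt_p lt_s; rewrite /opp.
  case: r lt_r => [|r] lt_r; case: s lt_s => [|s] lt_s //.
  - by rewrite subn0 modnn modn_small; lia.
  - by rewrite subn0 modnn modn_small; lia.
  - by rewrite !modn_small; lia.
move=> y /mapP[h hH ->]; rewrite mem_filter mem_iota /= ltn_mod p_gt0 andbT.
apply/allPn; exists h => //; rewrite negbK /dvdn /opp modnDml -modnDmr.
by rewrite subnK ?modnn // ltnW // ltn_mod.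
Qed.

(** A prime modulo which two elements of [H] coincide divides their difference,
    a positive integer below [2 ^ b], which has at most [b] prime factors. *)
Lemma count_colliding_primes b (ps H : seq nat) :
    uniq ps -> all prime ps -> uniq H -> all (fun h => h < 2 ^ b) H ->
  count (fun p => ~~ uniq [seq h %% p | h <- H]) ps <= size H * size H * b.
Proof.
move=> uniq_ps prime_ps uniq_H /allP lt_H.
pose D h h' := (h - h') + (h' - h).
pose B := flatten [seq primes (D h h') | h <- H, h' <- H].
have le_B : size B <= size H * size H * b.
  rewrite /B -(size_allpairs (fun h h' => primes (D h h'))).
  have /allP : {in [seq primes (D h h') | h <- H, h' <- H],
      forall l, size l <= b}.
    move=> l /allpairsP[[h h'] /= [/lt_H lt_h /lt_H lt_h' ->]].
    case: (posnP (D h h')) => [-> //|D_gt0].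
    rewrite -(leq_exp2l _ _ (ltnSn 1)).
    apply: leq_trans (expn2_size_primes D_gt0) _.
    by rewrite /D; lia.
  elim: [seq _ | _ <- _, _ <- _] => //= l L IHL /andP[le_l /IHL le_L].
  by rewrite size_cat mulSn leq_add.
have dvd_D p h h' : h = h' %[mod p] -> p %| D h h'.
  move=> /eqP eq_hh'; rewrite /D; have [le|/ltnW le] := leqP h h'.
    move: le (le); rewrite -{1}subn_eq0 => /eqP-> le.
    by rewrite -eqn_mod_dvd 1?eq_sym.
  move: le (le); rewrite -{1}subn_eq0 => /eqP-> le.
  by rewrite addn0 -eqn_mod_dvd.
apply: leq_trans le_B; rewrite -size_filter; apply: uniq_leq_size.
  exact: filter_uniq.
move=> p; rewrite mem_filter => /andP[/(uniqPn 0)[i [j [lt_ij]]]].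
rewrite size_map => lt_j; have lt_i := ltn_trans lt_ij lt_j.
rewrite !(nth_map 0) // => eq_ij p_ps.
apply/flattenP; exists (primes (D (nth 0 H i) (nth 0 H j))).
  by apply: allpairs_f; rewrite mem_nth.
rewrite mem_primes (allP prime_ps) //=.
have neq_ij : nth 0 H i != nth 0 H j by rewrite nth_uniq // ltn_eqF.
apply/andP; split; first by rewrite /D; lia.
exact: dvd_D.
Qed.

(** Bernoulli's inequality, in the form [(1 - 1 / q) ^ q <= 1 / 2]. *)
Lemma leq_double_expn_pred q : 0 < q -> 2 * q.-1 ^ q <= q ^ q.
Proof.
case: q => // s _; rewrite succnK; case: (posnP s) => [-> //|s_gt0].
have bern n : s ^ n * (s + n) <= s.+1 ^ n * s.
  elim: n => [|n IHn]; first by rewrite addn0.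
  apply: (@leq_trans (s.+1 * (s ^ n * (s + n)))).
    rewrite expnS; set c := s ^ n; nia.
  by rewrite [s.+1 ^ _]expnS -mulnA leq_mul2l IHn orbT.
have := bern s.+1; set c := s ^ _; set d := s.+1 ^ _; nia.
Qed.

Lemma leq_prod_ratio (ps : seq nat) (good : pred nat) (c : nat -> nat) q :
    (forall p, p \in ps -> c p <= p) ->
    (forall p, p \in ps -> good p -> c p * q <= p * q.-1) ->
  (\prod_(p <- ps) c p) * q ^ count good ps <=
  (\prod_(p <- ps) p) * q.-1 ^ count good ps.
Proof.
elim: ps => [|p ps IHps] le_c le_cq; first by rewrite !big_nil.
have {}IHps := IHps (fun r r_ps => le_c r (mem_behead (s := p :: ps) r_ps))
                    (fun r r_ps => le_cq r (mem_behead (s := p :: ps) r_ps)).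
rewrite !big_cons /= !expnD mulnACA [leqRHS]mulnACA leq_mul //.
have p_in : p \in p :: ps by rewrite mem_head.
case: (boolP (good p)) => [/le_cq|_]; rewrite ?expn1 ?muln1; first exact.
exact: le_c.
Qed.

(** A sieve over a full period.  Apart from at most [|H| ^ 2 * b] primes, the
    set [H] occupies [|H|] residue classes modulo [p], so requiring that [p]
    divides no [x + h] costs a factor [1 - |H| / p <= 1 - 1 / q]; every [q] of
    these primes halve the density. *)
Lemma count_shifts_coprime (ps H : seq nat) q e b :
    uniq ps -> all (fun p => prime p && (p <= size H * q)) ps ->
    uniq H -> all (fun h => h < 2 ^ b) H ->
    0 < q -> size H * size H * b + q * e <= size ps ->
  count (fun x => all (fun p => all (fun h => ~~ (p %| x + h)) H) ps)
        (iota 0 (\prod_(p <- ps) p)) * 2 ^ e <= \prod_(p <- ps) p.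
Proof.
move=> uniq_ps; rewrite all_predI => /andP[prime_ps /allP le_ps] uniq_H lt_H.
move=> q_gt0 le_size; set X := \prod_(p <- ps) p.
pose G p y := all (fun h => ~~ (p %| y + h)) H.
pose good p := uniq [seq h %% p | h <- H].
have eqG x : all (fun p => all (fun h => ~~ (p %| x + h)) H) ps =
             all (fun p => G p (x %% p)) ps.
  apply: eq_all => p; apply: eq_all => h.
  by rewrite /dvdn modnDml.
rewrite (eq_count eqG).
set r := count good ps.
have r_ge : q * e <= r.
  have le_bad : count (predC good) ps <= size H * size H * b.
    exact: count_colliding_primes.
  by have := count_predC good ps; rewrite -/r; lia.
set c := count _ _; have le_c : c * q ^ r <= X * q.-1 ^ r.
  apply: leq_trans (leq_mul (count_sieve G uniq_ps prime_ps) (leqnn _)) _.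
  apply: leq_prod_ratio => p p_ps.
    by rewrite -[leqRHS](size_iota 0) count_size.
  move=> good_p; have p_gt0 : 0 < p by rewrite prime_gt0 ?(allP prime_ps).
  apply: leq_trans (leq_mul (count_avoiding p_gt0 good_p) (leqnn q)) _.
  by have := le_ps p p_ps => /=; move: (size H) => k; nia.
have pow_le : q.-1 ^ r * 2 ^ e <= q ^ r.
  rewrite -(subnKC r_ge) !expnD mulnAC leq_mul ?leq_expn2 ?leq_pred //.
  rewrite !expnM -expnMn; apply: leq_expn2 => //.
  by rewrite mulnC leq_double_expn_pred.
rewrite -(leq_pmul2r (_ : 0 < q ^ r)) ?expn_gt0 ?q_gt0 // mulnAC.
apply: leq_trans (leq_mul le_c (leqnn _)) _.
by rewrite -mulnA leq_mul2l pow_le orbT.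
Qed.

(** * Windows with many primes *)

(** Double counting: an element of [P] below [X] lies in [N] of the windows,
    unless it is one of the first [N] integers. *)
Lemma count_windows (P : pred nat) N X :
  N * count P (iota 0 X) <= N * N + \sum_(x <- iota 0 X) count P (iota x N).
Proof.
elim: N => [|N IHN]; first by rewrite mul0n.
have -> : \sum_(x <- iota 0 X) count P (iota x N.+1) =
    \sum_(x <- iota 0 X) count P (iota x N) + count P (iota N X).
  rewrite -[in iota N X](addn0 N) iotaDl count_map -sum1_count.
  rewrite [X in _ = _ + X]big_mkcond.
  rewrite -big_split; apply: eq_bigr => x _.
  rewrite -[N.+1]addn1 iotaD count_cat /= addn0 [N + x]addnC.
  by case: (P _).
have shift : count P (iota 0 X) <= N + count P (iota N X).
  have := count_size P (iota 0 N); rewrite size_iota => le_N.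
  have : count P (iota 0 X) <= count P (iota 0 (N + X)).
    by rewrite addnC iotaD count_cat leq_addr.
  by rewrite iotaD count_cat add0n; lia.
by move: IHN shift; set S := \sum_(_ <- _) _; nia.
Qed.

Lemma leq_sum_count (T : Type) (r : seq T) (c : T -> nat) k N :
    (forall x, c x <= N) ->
  \sum_(x <- r) c x <= k * size r + N * count (fun x => k <= c x) r.
Proof.
move=> c_le; elim: r => [|x r IHr]; first by rewrite big_nil.
rewrite big_cons /=; have := c_le x; move: IHr.
by case: (leqP k (c x)); lia.
Qed.

Lemma count_has (T W : Type) (r : seq T) (s : seq W) (F : W -> pred T) :
  count (fun x => has (F^~ x) s) r <= \sum_(w <- s) count (F w) r.
Proof.
elim: s => [|w s IHs] /=; first by rewrite count_pred0.
rewrite big_cons; apply: leq_trans (leq_add (leqnn _) IHs).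
by rewrite -count_predUI leq_addr.
Qed.

Definition ones (w : seq bool) : seq nat :=
  [seq i <- iota 0 (size w) | nth false w i].

Lemma size_ones_prime_word n N :
  size (ones (mkseq (fun m => prime (n + m)) N)) = count prime (iota n N).
Proof.
rewrite /ones size_mkseq -[in RHS](addn0 n) iotaDl count_map -size_filter.
congr size; apply: eq_in_filter => i; rewrite mem_iota => /andP[_ lt_i].
by rewrite nth_mkseq.
Qed.

(** If all windows of length [2 ^ b] have their pattern of primes in [s], then
    few windows contain [k] primes or more.  For each word of [s] with [k] ones,
    the shifts by the positions of its first [k] ones must avoid all of [ps]:
    a prime [x + h] is not divisible by a prime of [ps] when [x > z].  Summing
    the bound of [count_shifts_coprime] over [s] gives the claim, the [x <= z]
    being counted separately. *)
Lemma count_windows_pattern (s : seq (seq bool)) (ps : seq nat) k q e z b :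
    (forall n, mkseq (fun m => prime (n + m)) (2 ^ b) \in s) ->
    uniq ps -> all (fun p => [&& prime p, p <= z & p <= k * q]) ps ->
    0 < q -> k * k * b + q * e <= size ps ->
  count (fun x => k <= count prime (iota x (2 ^ b)))
        (iota 0 (\prod_(p <- ps) p)) * 2 ^ e <=
  z.+1 * 2 ^ e + size s * \prod_(p <- ps) p.
Proof.
move=> s_words uniq_ps /allP ps_bnd q_gt0 ps_size; set X := \prod_(p <- ps) p.
pose H w := take k (ones w).
pose avoids w x := all (fun p => all (fun h => ~~ (p %| x + h)) (H w)) ps.
pose F w x := [&& size w == 2 ^ b, size (H w) == k & avoids w x].
have F_le w : count (F w) (iota 0 X) * 2 ^ e <= X.
  have [sz|neq] := boolP ((size w == 2 ^ b) && (size (H w) == k)); last first.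
    rewrite (@eq_count _ _ pred0) ?count_pred0 // => x.
    by rewrite /F andbA (negPf neq).
  have /andP[/eqP sz_w /eqP sz_k] := sz.
  rewrite (@eq_count _ _ (avoids w)); last first.
    by move=> x; rewrite /F sz_w sz_k !eqxx.
  apply: (count_shifts_coprime (q := q) (b := b)); rewrite ?sz_k //.
  - by apply/allP=> p /ps_bnd/and3P[-> _ ->].
  - by rewrite take_uniq // filter_uniq ?iota_uniq.
  - apply/allP=> h /mem_take; rewrite mem_filter mem_iota sz_w.
    by case/andP=> _ /andP[].
pose M := \sum_(w <- s) count (F w) (iota 0 X).
apply: (@leq_trans ((z.+1 + M) * 2 ^ e)); last first.
  rewrite mulnDl leq_add2l big_distrl.
  apply: leq_trans (leq_sum _ (fun w _ => F_le w)) _.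
  by rewrite big_const_seq count_predT iter_addn_0 mulnC.
rewrite leq_mul2r; apply/orP; right.
apply: leq_trans (leq_add (leqnn _) (count_has _ _ _)).
have <- : count (fun x => x <= z) (iota 0 z.+1) = z.+1.
  rewrite (@eq_in_count _ _ predT) ?count_predT ?size_iota // => x.
  by rewrite mem_iota => /andP[_].
apply: (@leq_trans (count (fun x => x <= z) (iota 0 X) +
                    count (fun x => has (F^~ x) s) (iota 0 X))); last first.
  rewrite leq_add2r; case: (leqP X z.+1) => [le_X|/ltnW le_X].
    by rewrite -(subnKC le_X) iotaD count_cat leq_addr.
  rewrite -[in leqLHS](subnKC le_X) iotaD count_cat -[leqRHS]addn0.
  rewrite leq_add2l leqNgt -has_count; apply/hasPn => x; rewrite mem_iota.
  by case/andP => ? _; rewrite -ltnNge.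
rewrite -count_predUI; apply: leq_trans (leq_addr _ _).
apply: sub_count => x /= le_k; case: leqP => //= lt_zx.
apply/hasP; exists (mkseq (fun m => prime (x + m)) (2 ^ b)) => //.
set w := mkseq _ _.
rewrite /F size_mkseq eqxx size_takel ?size_ones_prime_word // eqxx /=.
apply/allP => p /ps_bnd/and3P[p_pr le_pz _]; apply/allP => h /mem_take.
rewrite mem_filter mem_iota size_mkseq /= => /andP[w_h lt_h].
move: w_h; rewrite nth_mkseq // => xh_pr.
by rewrite dvdn_prime2 //; lia.
Qed.

(** * Complexity of the primes *)

Lemma expn3_leq_expn2 u : 10 <= u -> u ^ 3 <= 2 ^ u.
Proof.
elim: u => // u IHu; rewrite leq_eqVlt => /predU1P[<- //|].
rewrite ltnS => le_u; have := IHu le_u; rewrite [2 ^ u.+1]expnS.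
move: (2 ^ u) => t; rewrite !expnS !expn0 !muln1 => le_t.
apply: leq_trans (_ : _ <= 2 * (u * (u * u))) _; last by rewrite leq_mul2l le_t.
by nia.
Qed.

Lemma leq_sieve_budget u t e : 8 * u * (7 * u + e) <= t ->
  8 * u * (t * t * (u * 7) + t ^ 3 * e) <= t ^ 4.
Proof.
case: t => [|t] le_t; first by lia.
rewrite mulnDr; apply: (@leq_trans (t.+1 ^ 3 * (8 * u * (7 * u + e)))).
  rewrite !expnS expn0 !muln1; move: (t) => a; nia.
by rewrite [t.+1 ^ 4]expnSr leq_mul2l le_t orbT.
Qed.

(** [P] is the number of primes below [X], [S] the total number of primes in
    the windows of length [N], and [G] the number of windows with at least [t]
    primes.  As the primes have density about [1 / Y], the order of magnitude
    of [S] is at least [N * X / Y].  The windows with fewer than [t] primes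
    contribute at most a quarter of this, and so do those counted by [G],
    except for the first [z + 1]; hence [X] cannot be large. *)
Lemma leq_period_of_counts (Y z t N X P S G : nat) : 0 < N ->
    N * P <= N * N + S -> X <= Y * P.+1 -> S <= t * X + N * G ->
    G * (4 * Y) <= z.+1 * (4 * Y) + X -> 4 * Y * t <= N ->
  X <= 2 * Y * (N + z + 2).
Proof.
move=> N_gt0 leP leX leS leG leN.
rewrite -(leq_pmul2l (_ : 0 < N * 2)) ?muln_gt0 ?N_gt0 //.
have h1 : 4 * (N * X) <= 4 * Y * (N * N + (t * X + N * G)) + 4 * Y * N.
  apply: (@leq_trans (4 * (N * (Y * P.+1)))).
    by rewrite !leq_mul2l leX !orbT.
  have : Y * (N * P) <= Y * (N * N + (t * X + N * G)).
    by rewrite leq_mul2l (leq_trans leP) ?orbT // leq_add2l.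
  by lia.
have h2 : 4 * Y * t * X <= N * X by rewrite leq_mul2r leN orbT.
have h3 : N * (G * (4 * Y)) <= N * (z.+1 * (4 * Y) + X).
  by rewrite leq_mul2l leG orbT.
by lia.
Qed.

Lemma ltn_period_scales u t z N : 0 < t -> u <= t -> z <= N -> 10 <= z ->
  2 * (8 * u * z) * (N + z + 2) < 128 * (t * (z * N)).
Proof.
move=> t_gt0 le_ut le_zN z_ge.
have le3 : N + z + 2 <= 3 * N by lia.
have := leq_mul (leq_mul le_ut (leqnn z)) le3.
have : 0 < t * (z * N) by rewrite !muln_gt0; lia.
lia.
Qed.

(** The parameters are powers of [t = 2 ^ u]: windows of length [N = t ^ 7],
    sieving primes up to [z = t ^ 4], and [k = t] primes per window.  With [X]
    the product of the sieving primes, [X <= z ^ z] and Chebyshev's bound give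
    an average of at least about [N / (8 * u * z)] primes in a window below
    [X], which is much more than [t].  The sieve gains a factor [2 ^ e] for any
    [e] up to about [t / (8 * u)], whereas an [e] of order [C * u] already
    beats the number of words: it is enough that [2 ^ u] dominates a multiple
    of [u ^ 2] depending on [C]. *)
Theorem prime_words_superpolynomial C :
  exists N, forall s : seq (seq bool), size s <= (N + 2) ^ C ->
    ~ forall n, mkseq (fun m => prime (n + m)) N \in s.
Proof.
have [u [u_ge u3_le]] : exists u,
    10 <= u /\ u ^ 2 * (8 * (8 * C + 17)) <= 2 ^ u.
  exists (8 * (8 * C + 17)); split; first by lia.
  by rewrite -expnSr expn3_leq_expn2 //; lia.
(* [2 ^ e] absorbs the number of words times the factor [32 * u * z]. *)
pose e := (7 * u + 1) * C + (5 * u + 5).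
(* [t], [z] and [N] are kept abstract: only the equations relating them
   matter. *)
have [t tE] : {t | t = 2 ^ u} by exists (2 ^ u).
have [z zt] : {z | z = t ^ 4} by exists (t ^ 4).
have [N Nt] : {N | N = t ^ 7} by exists (t ^ 7).
exists N => s le_s s_words.
have le_ut : u <= t by rewrite tE ltnW // ltn_expl.
have t_ge : 32 <= t by rewrite tE (@leq_exp2l 2 5) //; lia.
have t_large : 8 * u * (7 * u + e) <= t.
  rewrite tE; apply: leq_trans u3_le; rewrite -mulnn.
  have le_C : C <= u * C by rewrite leq_pmull //; lia.
  have le_e : 7 * u + e <= u * (8 * C + 17) by rewrite /e; lia.
  by have := leq_mul (leqnn (8 * u)) le_e; lia.
have zE : z = 2 ^ (u * 4) by rewrite zt tE expnM.
have NE : N = 2 ^ (u * 7) by rewrite Nt tE expnM.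
have t_gt0 : 0 < t by rewrite tE expn_gt0.
have z_ge : 10 <= z.
  rewrite (leq_trans u_ge) // (leq_trans le_ut) // zt expnS leq_pmulr //.
  by rewrite expn_gt0 t_gt0.
have even_z : ~~ odd z by rewrite zE oddX; lia.
pose ps := [seq p <- iota 0 z.+1 | prime p].
have z_le : z <= 8 * u * size ps.
  have := chebyshev_expn2 (leq_trans (isT : 0 < 10) z_ge) even_z (eq_leq zE).
  by rewrite -size_filter -/ps; lia.
pose X := \prod_(p <- ps) p.
have ps_pr : all prime ps by rewrite filter_all.
have ps_le_z : size ps <= z.
  rewrite size_filter.
  by have := count_size prime (iota 1 z); rewrite size_iota.
have ps_large : t * t * (u * 7) + t ^ 3 * e <= size ps.
  rewrite -(leq_pmul2l (_ : 0 < 8 * u)); last by lia.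
  by apply: leq_trans z_le; rewrite zt; exact: leq_sieve_budget.
have size_ps : 12 * u + 6 < size ps.
  have le_e : 2 ^ 3 * e <= t ^ 3 * e.
    by rewrite leq_mul2r leq_exp2r ?orbT //; lia.
  apply: leq_trans (leq_trans (leq_addl _ _) ps_large).
  by apply: leq_trans le_e; rewrite /e; lia.
have X_ge : 2 ^ size ps <= X.
  rewrite -(count_predT ps) -iter_muln_1 -big_const_seq /X.
  rewrite big_seq [leqRHS]big_seq; apply: leq_prod => p p_ps.
  by rewrite prime_gt1 // (allP ps_pr).
have X_le : X <= 2 ^ (u * 4 * z).
  apply: (@leq_trans (z ^ size ps)).
    rewrite -(count_predT ps) -iter_muln_1 -big_const_seq /X.
    rewrite big_seq [leqRHS]big_seq; apply: leq_prod => p.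
    by rewrite mem_filter mem_iota => /andP[_ /andP[]].
  by rewrite expnM -zE leq_pexp2l //; lia.
have even_X : ~~ odd X.
  rewrite -dvdn2 /X (big_rem 2) ?dvdn_mulr //= mem_filter mem_iota /=.
  by lia.
have X_gt0 : 0 < X by apply: leq_trans X_ge; rewrite expn_gt0.
have pi_X : X <= 8 * u * z * (count prime (iota 0 X)).+1.
  apply: leq_trans (chebyshev_expn2 X_gt0 even_X X_le) _.
  rewrite -[in X in X <= _](addn1 X) iotaD count_cat /=.
  apply: leq_mul; first by lia.
  by case: (prime _); lia.
have windows := count_windows prime N X.
set G := count (fun x => t <= count prime (iota x N)) (iota 0 X).
have sum_le : \sum_(x <- iota 0 X) count prime (iota x N) <= t * X + N * G.
  rewrite -[in t * X](size_iota 0 X); apply: leq_sum_count => x.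
  by rewrite -[leqRHS](size_iota x) count_size.
have G_le : G * 2 ^ e <= z.+1 * 2 ^ e + size s * X.
  rewrite /G NE; apply: (count_windows_pattern (q := t ^ 3)) => //.
  - by rewrite -NE.
  - by rewrite filter_uniq ?iota_uniq.
  - apply/allP => p; rewrite mem_filter mem_iota => /andP[-> /andP[_ p_le]].
    by rewrite -expnS -zt andbb.
  - by rewrite expn_gt0 t_gt0.
have s_le : size s * (32 * u * z) <= 2 ^ e.
  have -> : 2 ^ e = (2 ^ (7 * u + 1)) ^ C * (32 * (t * z)).
    rewrite -expnM zE tE (_ : 32 = 2 ^ 5) // -!expnD.
    by congr (2 ^ _); rewrite /e; lia.
  apply: leq_mul.
    apply: leq_trans le_s _; apply: leq_expn2.
    have : 1 < N by rewrite NE -[X in X < _]/(2 ^ 0) ltn_exp2l //; lia.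
    by rewrite addn1 expnS [7 * u]mulnC -NE; lia.
  by rewrite -mulnA leq_mul2l leq_mul2r le_ut !orbT.
have G_le' : G * (32 * u * z) <= z.+1 * (32 * u * z) + X.
  rewrite -(leq_pmul2r (_ : 0 < 2 ^ e)) ?expn_gt0 //.
  rewrite mulnAC; apply: leq_trans (leq_mul G_le (leqnn _)) _.
  by have := leq_mul s_le (leqnn X); move: (2 ^ e) => E; lia.
have X_large : 2 * (8 * u * z) * (N + z + 2) < X.
  apply: leq_trans X_ge; apply: (@leq_trans (2 ^ (12 * u + 7))); last first.
    by rewrite leq_exp2l //; lia.
  have -> : 2 ^ (12 * u + 7) = 128 * (t * (z * N)).
    by rewrite zE NE tE (_ : 128 = 2 ^ 7) // -!expnD; congr (2 ^ _); lia.
  by apply: ltn_period_scales => //; rewrite zE NE leq_exp2l //; lia.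
have leN : 4 * (8 * u * z) * t <= N.
  have t2 : 32 * u <= t * t by apply: leq_trans (leq_mul t_ge le_ut).
  have := leq_mul t2 (leqnn (z * t)).
  by rewrite Nt zt !expnS expn0; lia.
have N_gt0 : 0 < N by rewrite NE expn_gt0.
move: X_large; rewrite ltnNge => /negP; apply.
apply: (leq_period_of_counts N_gt0 windows pi_X sum_le _ leN).
by move: G_le'; lia.
Qed.

(** * The primes are not a bracket word *)

Local Open Scope classical_set_scope.
Unset Implicit Arguments.

Theorem proposition11p11 (R : realType) :
  ~ bracket_word R (char_word [set p : nat | prime p]).
Proof.
move=> /bracket_word_complexity[C words].
have [N not_covered] := prime_words_superpolynomial C.
have [s [s_size s_words]] := words N.
apply: (not_covered s s_size) => n.
have := s_words n; congr (_ \in s); apply: eq_mkseq => m.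
by rewrite /char_word; apply/idP/idP; rewrite inE.
Qed.
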